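(* Let $m, k, n$ be positive integers, let $f(t) = \Phi_m(t)^k$ be the $k$th power of the $m$th cyclotomic polynomial, and let $b$ be the largest divisor of $n$ for which $\gcd(b,m)=1$. Then $f(t)$ is $n$-Hartley if and only if $n/b$ divides $k$.
   Context: For a positive integer $n$, let $\zeta_n = \exp(2\pi i/n)$. A polynomial $\Delta(t) \in \mathbf{Z}[t]$ is called $n$-Hartley if there exists $g(t) \in \mathbf{Z}[t]$ such that $\Delta(t^n) = \pm \prod_{i=0}^{n-1} g(\zeta_n^i t)$ (for some choice of sign). *)

(* Defs.v *)
From HB Require Import structures.
From mathcomp Require Import all_boot all_order all_algebra all_field.
From mathcomp Require Import reals trigo.
From mathcomp Require Import complex.

Set Implicit Arguments.
Unset Strict Implicit.
Unset Printing Implicit Defensive.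

Import GRing.Theory.

Local Open Scope ring_scope.
Local Open Scope complex_scope.

(* exp (2 pi i / n), written out by Euler's formula. *)
Definition zeta (R : realType) (n : nat) : R[i] :=
  cos (2 * pi / n%:R) +i* sin (2 * pi / n%:R).

(* The equation is one between polynomials over the complex numbers R[i]:
   the factors g (zeta_n ^ i t) need not have integer coefficients. *)
Definition Hartley (R : realType) (n : nat) (Delta : {poly int}) : Prop :=
  exists g : {poly int},
    let P : {poly R[i]} :=
      \prod_(i < n) (map_poly intr g \Po (zeta R n ^+ i *: 'X)) in
    let D : {poly R[i]} := map_poly intr (Delta \Po 'X^n) in
    D = P \/ D = - P.

(* Main.v *)
(** Write n = a b.  By maximality of b, every prime factor of a divides m, so
    phi(m a d) = a phi(m) phi(d) for every divisor d of b.

    If a divides k, take g = Phi_(m a)^(k/a): the n-th power map sends the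
    primitive (m a)-th roots of unity a-to-one onto the primitive m-th ones, so
    prod_i Phi_(m a)(zeta^i t) = +- Phi_m(t^n)^a.

    Conversely, g divides Phi_m(t^n)^k, and every root of Phi_m(t^n) has order
    m a d with d dividing b.  Cyclotomic polynomials being irreducible over Q,
    deg g is a sum of values phi(m a d), hence a multiple of a phi(m); comparing
    degrees gives deg g = k phi(m), so a divides k. *)

Require Import Defs.
From mathcomp Require Import all_boot all_order all_algebra all_field.
From mathcomp Require Import reals.
From mathcomp Require Import trigo complex ring lra.

Set Implicit Arguments.
Unset Strict Implicit.
Unset Printing Implicit Defensive.

Import Order.TTheory GRing.Theory Num.Theory.

Local Open Scope ring_scope.

(** * Iterated operations over residues; the totient *)

Section BigMod.

Variables (T : Type) (idx : T) (op : Monoid.law idx).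

Lemma big_mod_mul (m a : nat) (P : pred nat) (F : nat -> T) :
  \big[op/idx]_(0 <= k < a * m | P (k %% m)%N) F (k %% m)%N =
  \big[op/idx]_(q < a) \big[op/idx]_(0 <= j < m | P j) F j.
Proof.
rewrite big_mkcond big_nat_mul big_mkord; apply: eq_bigr => q _.
rewrite -{1}[(q * m)%N]add0n big_addn mulSn addnK [RHS]big_mkcond.
apply: eq_big_nat => j /andP[_ lt_jm].
by rewrite addnC modnMDl modn_small.
Qed.

(* The hypothesis says that every prime factor of [a] divides [m]. *)
Lemma big_coprime_mod (m a : nat) (F : nat -> T) :
    (forall d, coprime d m -> coprime d a) ->
  \big[op/idx]_(k < m * a | coprime k (m * a)) F (k %% m)%N =
  \big[op/idx]_(q < a) \big[op/idx]_(j < m | coprime j m) F j.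
Proof.
move=> co_ma; rewrite mulnC.
rewrite -(big_mkord (coprime^~ (a * m)%N) (fun k => F (k %% m)%N)).
(* Coprimality to [a * m] amounts to coprimality to [m], which depends only on [k %% m]. *)
rewrite (eq_bigl (fun k => coprime (k %% m) m)) => [|k]; last first.
  rewrite coprime_modl coprimeMr andbC.
  by case co_km: (coprime k m); rewrite // co_ma.
rewrite (big_mod_mul m a (coprime^~ m)).
by apply: eq_bigr => q _; rewrite big_mkord.
Qed.

End BigMod.

Lemma totient_mul_support (m a : nat) :
    (forall d, coprime d m -> coprime d a) ->
  totient (m * a) = (a * totient m)%N.
Proof.
move=> co_ma.
have totE n : totient n = (\sum_(k < n | coprime k n) 1)%N.
  rewrite totient_count_coprime big_mkord [RHS]big_mkcond.
  by apply: eq_bigr => k _; rewrite coprime_sym; case: coprime.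
rewrite !totE (big_coprime_mod addn (fun=> 1%N)) //.
by rewrite sum_nat_const card_ord.
Qed.

(** * Cyclotomic polynomials over a field with roots of unity *)

Section Roots.

Variable F : fieldType.

(** Strong induction on [n]: both families multiply over the divisors of [n] to ['X^n - 1], and the
    product [q] over the proper divisors cancels. *)
Lemma map_Cyclotomic (n : nat) (z : F) :
  n.-primitive_root z -> map_poly intr 'Phi_n = cyclotomic z n.
Proof.
elim/ltn_ind: n z => n IHn z prim_z.
have n_gt0 := prim_order_gt0 prim_z.
have n_in : n \in divisors n by rewrite -dvdn_divisors.
pose q := \prod_(d <- rem n (divisors n)) cyclotomic (z ^+ (n %/ d)) d.
have q_neq0 : q != 0.
  by rewrite monic_neq0 // monic_prod // => d _; apply: cyclotomic_monic.
apply: (mulIf q_neq0).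
have -> : cyclotomic z n * q = 'X^n - 1.
  by rewrite (prod_cyclotomic prim_z) (big_rem n) //= divnn n_gt0 expr1.
transitivity (map_poly intr ('X^n - 1) : {poly F}); last first.
  by rewrite rmorphB /= rmorph1 map_polyXn.
rewrite -prod_Cyclotomic // (big_rem n) //= rmorphM rmorph_prod /=.
congr (_ * _); apply: eq_big_seq => d.
rewrite mem_rem_uniq ?divisors_uniq // inE -dvdn_divisors //= => /andP[d_neq d_dv].
rewrite -IHn ?dvdn_prim_root //.
by rewrite ltn_neqAle d_neq dvdn_leq.
Qed.

Lemma prim_rootV (n : nat) (z : F) :
  n.-primitive_root z -> n.-primitive_root z^-1.
Proof.
move=> prim_z; have n_gt0 := prim_order_gt0 prim_z.
have -> : z^-1 = z ^+ n.-1.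
  have z_neq0 : z != 0 by rewrite (prim_root_eq0 prim_z) -lt0n.
  apply: (mulfI z_neq0); rewrite divff // -exprS prednK //.
  by rewrite prim_expr_order.
by rewrite prim_root_exp_coprime // coprime_sym coprimenP.
Qed.

(** Each factor is [z ^+ i * c] times [c^-1 *: 'X - z ^- i], so the factorization of ['X^n - 1] by
    powers of [z^-1], taken at [c^-1 *: 'X], applies. The sign is the product of the [z ^+ i], read
    off from the constant term of ['X^n - 1]. *)
Lemma prod_scaleX_sub (n : nat) (z c : F) : n.-primitive_root z -> c != 0 ->
  \prod_(i < n) (z ^+ i *: 'X - c%:P) = (-1) ^+ n.+1 *: ('X^n - (c ^+ n)%:P).
Proof.
move=> prim_z c_neq0; have n_gt0 := prim_order_gt0 prim_z.
have z_neq0 : z != 0 by rewrite (prim_root_eq0 prim_z) -lt0n.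
have prodz : \prod_(i < n) z ^+ i = (-1) ^+ n.+1.
  have /(congr1 (horner^~ 0)) := factor_Xn_sub_1 prim_z.
  rewrite big_mkord horner_prod !hornerE expr0n -[in n == _](prednK n_gt0) /= sub0r.
  under eq_bigr => i _ do rewrite !hornerE -mulN1r.
  rewrite big_split prodr_const card_ord /= => prodE.
  by rewrite exprSr -[X in _ = _ * X]prodE mulrA -expr2 sqrr_sign mul1r.
have /(congr1 (comp_poly (c^-1 *: 'X))) := factor_Xn_sub_1 (prim_rootV prim_z).
rewrite big_mkord rmorph_prod rmorphB rmorph1 /= comp_Xn_poly exprZn exprVn => prodE.
have -> : 'X^n - (c ^+ n)%:P = c ^+ n *: (c ^- n *: 'X^n - 1) :> {poly F}.
  by rewrite scalerBr scalerA divff ?expf_neq0 // scale1r alg_polyC.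
have cnE : c ^+ n = \prod_(i < n) c by rewrite prodr_const card_ord.
rewrite -prodE -prodz cnE -!scaler_prod.
apply: eq_bigr => i _.
rewrite rmorphB /= comp_polyX comp_polyC -!mul_polyC !mulrBr !mulrA -!polyCM.
by rewrite exprVn mulfK // mulrAC divff ?mul1r // expf_neq0.
Qed.

(** For a root [w ^+ k] of ['Phi_(m * a)] the product over [i] is ['X^n - w ^+ (n * k)] up to sign.
    As [w ^+ n] has order [m], this depends only on [k %% m], and every residue prime to [m] occurs
    [a] times. *)
Lemma prod_cyclotomic_scaleX (m a n : nat) (z w : F) :
    n.-primitive_root z -> (m * a).-primitive_root w ->
    (forall d, coprime d m -> coprime d a) -> gcdn n (m * a) = a ->
  exists e : nat,
    \prod_(i < n) (map_poly intr 'Phi_(m * a) \Po (z ^+ i *: 'X)) =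
    (-1) ^+ e *: (map_poly intr ('Phi_m \Po 'X^n)) ^+ a.
Proof.
move=> prim_z prim_w co_ma gcd_a.
have w_neq0 : w != 0.
  by rewrite (prim_root_eq0 prim_w) -lt0n (prim_order_gt0 prim_w).
have prim_wn : m.-primitive_root (w ^+ n).
  have := exp_prim_root prim_w n; rewrite gcd_a mulnK //.
  by rewrite -gcd_a gcdn_gt0 (prim_order_gt0 prim_z).
rewrite map_comp_poly map_polyXn (map_Cyclotomic prim_w) (map_Cyclotomic prim_wn).
pose G j : {poly F} := 'X^n - (w ^+ n ^+ j)%:P.
have -> : cyclotomic (w ^+ n) m \Po 'X^n = \prod_(j < m | coprime j m) G j.
  rewrite rmorph_prod /=; apply: eq_bigr => j _.
  by rewrite rmorphB /= comp_polyX comp_polyC.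
rewrite -[X in _ ^+ X](card_ord a) -prodr_const -big_coprime_mod //.
(* One sign [(-1) ^+ n.+1] for each root of ['Phi_(m * a)]. *)
exists (n.+1 * #|[pred k : 'I_(m * a) | coprime k (m * a)]|)%N.
rewrite exprM -prodr_const -scaler_prod.
rewrite (eq_bigr (fun i : 'I_n => \prod_(k < m * a | coprime k (m * a))
    (z ^+ i *: 'X - (w ^+ k)%:P))) => [|i _]; last first.
  rewrite rmorph_prod /=; apply: eq_bigr => k _.
  by rewrite rmorphB /= comp_polyX comp_polyC.
rewrite exchange_big /=; apply: eq_bigr => k _.
rewrite (prod_scaleX_sub prim_z) ?expf_neq0 //.
by rewrite /G (prim_expr_mod prim_wn) -!exprM mulnC.
Qed.

End Roots.

(** * Primitivity of exp(2 pi i / n) *)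

Lemma de_Moivre (R : realType) (x : R) (k : nat) :
  (cos x +i* sin x)%C ^+ k = (cos (x *+ k) +i* sin (x *+ k))%C.
Proof.
elim: k => [|k IHk]; first by rewrite expr0 !mulr0n cos0 sin0.
rewrite exprS IHk mulrS cosD sinD; simpc.
by congr (_ +i* _)%C; rewrite addrC.
Qed.

Lemma zeta_prim_root (R : realType) (n : nat) :
  (0 < n)%N -> n.-primitive_root (zeta R n).
Proof.
move=> n_gt0; rewrite /primitive_root_of_unity n_gt0 /=.
have n_gt0R : 0 < n%:R :> R by rewrite ltr0n.
apply/forallP => i; rewrite unity_rootE de_Moivre.
(* Half angles: a power equal to 1 makes the sine of the half angle vanish, but for [i.+1 < n] this
   angle lies strictly between 0 and [pi]. *)
have -> : 2 * pi / n%:R *+ i.+1 = (pi * i.+1%:R / n%:R) *+ 2 :> R.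
  rewrite -[LHS]mulr_natr -[RHS]mulr_natr.
  by move: (n%:R^-1) (i.+1%:R) => u v; ring.
have [i_eq|i_neq] := eqVneq i.+1 n.
  by rewrite i_eq mulfK ?(gt_eqF n_gt0R) // cos2pi sin2pi !eqxx.
have lt_in : (i.+1 < n)%N by rewrite ltn_neqAle i_neq ltn_ord.
have sin_gt0 : 0 < sin (pi * i.+1%:R / n%:R : R).
  rewrite sin_gt0_pi // divr_gt0 ?mulr_gt0 ?pi_gt0 ?ltr0n //=.
  by rewrite ltr_pdivrMr // ltr_pM2l ?pi_gt0 // ltr_nat.
rewrite eqbF_neg; apply/negP; rewrite eq_complex /= => /andP[/eqP + _].
rewrite cos_mulr2n cos2sin2 => cos_eq1.
have /eqP : sin (pi * i.+1%:R / n%:R : R) ^+ 2 = 0 by lra.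
by rewrite expf_eq0 /= gt_eqF.
Qed.

(** * Orders of roots and divisibility of degrees *)

Lemma prim_order_unique (R : nzRingType) (m n : nat) (z : R) :
  m.-primitive_root z -> n.-primitive_root z -> m = n.
Proof.
move=> prim_m prim_n; apply/eqP; rewrite eqn_dvd.
rewrite (prim_order_dvd prim_m) (prim_order_dvd prim_n).
by rewrite !prim_expr_order // eqxx.
Qed.

(* Such an [x] has order [m * a * d] for some [d] dividing [b], and
   [m * a] and [d] are coprime. *)
Lemma root_Cyclotomic_comp (m a b : nat) (x : algC) :
    (0 < m)%N -> (0 < a * b)%N ->
    (forall d, coprime d m -> coprime d a) -> coprime b m ->
    root (map_poly intr ('Phi_m \Po 'X^(a * b))) x ->
  exists o : nat, o.-primitive_root x /\ (a * totient m %| totient o)%N.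
Proof.
move=> m_gt0 n_gt0 co_ma co_bm.
have [w prim_w] := C_prim_root_exists m_gt0.
rewrite map_comp_poly map_polyXn (Cintr_Cyclotomic prim_w).
rewrite /root horner_comp hornerXn -/(root _ _) (root_cyclotomic prim_w).
set n := (a * b)%N in n_gt0 * => prim_xn.
have [||o prim_x _] := @prim_order_exists _ (n * m) x.
- by rewrite muln_gt0 n_gt0.
- by rewrite exprM prim_expr_order.
exists o; split=> //.
have o_gt0 := prim_order_gt0 prim_x.
have := prim_order_unique (exp_prim_root prim_x n) prim_xn.
set e := gcdn n o => oE.
have e_gt0 : (0 < e)%N by rewrite gcdn_gt0 n_gt0.
have {}oE : o = (m * e)%N by rewrite -oE divnK // dvdn_gcdr.
have /dvdnP[f nE] : (e %| n)%N by apply: dvdn_gcdl.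
(* Since [gcdn f m * e = gcdn n o = e], the cofactor [f] is prime to [m], hence to [a], and so
   divides [b]; this yields [e = a * d]. *)
have co_fm : coprime f m.
  by rewrite /coprime -(eqn_pmul2r e_gt0) muln_gcdl mul1n -nE -oE.
have /dvdnP[d bE] : (f %| b)%N.
  by rewrite -(Gauss_dvdr _ (co_ma _ co_fm)) -/n nE dvdn_mulr.
have f_gt0 : (0 < f)%N by move: n_gt0; rewrite nE muln_gt0 => /andP[].
have eE : e = (a * d)%N.
  by apply/eqP; rewrite -(eqn_pmul2r f_gt0) mulnC -nE /n bE mulnA.
have co_dm : coprime d m by move: co_bm; rewrite bE coprimeMl => /andP[].
rewrite oE eE mulnA totient_coprime; last first.
  by rewrite coprime_sym coprimeMr co_dm co_ma.
by rewrite totient_mul_support // dvdn_mulr.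
Qed.

(** Induction on the size: the minimal polynomial over the rationals of a root of order [o] is
    cyclotomic, of degree [totient o]; it is split off and the quotient treated in turn. *)
Lemma size_dvd_of_roots (c : nat) (p : {poly rat}) :
    p != 0 ->
    (forall x : algC, root (map_poly ratr p) x ->
      exists o : nat, o.-primitive_root x /\ (c %| totient o)%N) ->
  (c %| (size p).-1)%N.
Proof.
have [s] := ubnP (size p); elim: s p => // s IHs p /ltnSE le_ps p_neq0 roots.
have [/eqP size1|size_neq1] := eqVneq (size p) 1.
  by rewrite (eqP size1) dvdn0.
have /closed_rootP[x x_root] : size (map_poly ratr p : {poly algC}) != 1.
  by rewrite size_map_poly.
have [o [prim_x c_dvd]] := roots x x_root.
have [r [rE r_monic] r_dvd] := minCpolyP x.
have /dvdpP[q pE] : r %| p by rewrite -r_dvd.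
have size_r : size r = (totient o).+1.
  rewrite -(size_map_poly (ratr : rat -> algC)) -rE.
  by rewrite (minCpoly_cyclotomic prim_x) size_cyclotomic.
have q_neq0 : q != 0 by apply: contraNneq p_neq0 => q0; rewrite pE q0 mul0r.
have size_p : (size p).-1 = ((size q).-1 + totient o)%N.
  by rewrite pE size_mul ?(monic_neq0 r_monic) // size_r (polySpred q_neq0) addnS.
have o_gt0 := prim_order_gt0 prim_x.
rewrite size_p dvdn_add // IHs //.
  apply: leq_trans le_ps; rewrite (polySpred p_neq0) size_p.
  by rewrite {1}(polySpred q_neq0) ltnS -addn1 leq_add2l totient_gt0.
move=> y y_root; apply: roots; rewrite pE rmorphM rootM.
by rewrite y_root.
Qed.

(** * The criterion for powers of cyclotomic polynomials *)

Theorem proposition1p5 (R : realType) (m k n b : nat)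
    (m_gt0 : (0 < m)%N) (k_gt0 : (0 < k)%N) (n_gt0 : (0 < n)%N)
    (b_dvd : (b %| n)%N) (b_coprime : gcdn b m = 1%N)
    (b_max : forall d : nat, (d %| n)%N -> gcdn d m = 1%N -> (d <= b)%N) :
  Hartley R n ('Phi_m ^+ k) <-> (n %/ b %| k)%N.
Proof.
set a := (n %/ b)%N.
have nE : n = (a * b)%N by rewrite divnK.
have [a_gt0 b_gt0] : (0 < a)%N /\ (0 < b)%N.
  by apply/andP; rewrite -muln_gt0 -nE.
have co_bm : coprime b m by apply/eqP.
(* [gcdn d a * b] divides [n] and is prime to [m], so maximality of [b] forces [gcdn d a = 1]. *)
have co_ma d : coprime d m -> coprime d a.
  move=> co_dm; rewrite /coprime eqn_leq gcdn_gt0 a_gt0 orbT andbT.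
  rewrite -(leq_pmul2r b_gt0) mul1n; apply: b_max.
    by rewrite nE dvdn_pmul2r // dvdn_gcdr.
  by apply/eqP; rewrite -/(coprime _ _) coprimeMl co_bm andbT
    (coprime_dvdl (dvdn_gcdl _ _)).
have prim_z := zeta_prim_root R n_gt0.
split=> [[g /= g_eq]|/dvdnP[j kE]]; last first.
  have gcd_a : gcdn n (m * a) = a.
    by rewrite nE mulnC -muln_gcdl b_coprime mul1n.
  have ma_gt0 : (0 < m * a)%N by rewrite muln_gt0 m_gt0.
  have [e prodE] :=
    prod_cyclotomic_scaleX prim_z (zeta_prim_root R ma_gt0) co_ma gcd_a.
  exists ('Phi_(m * a) ^+ j) => /=.
  rewrite (eq_bigr (fun i : 'I_n =>
      (map_poly intr 'Phi_(m * a) \Po (zeta R n ^+ i *: 'X)) ^+ j)); last first.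
    by move=> i _; rewrite !rmorphXn.
  rewrite prodrXl prodE exprZn -exprM -signr_odd !rmorphXn /= -exprM (mulnC a) -kE.
  by case: odd; [right | left]; rewrite ?expr1 ?expr0 ?scaleN1r ?opprK ?scale1r.
set D : {poly int} := 'Phi_m ^+ k \Po 'X^n.
have D_neq0 : D != 0.
  rewrite comp_poly_eq0 ?size_polyXn // expf_neq0 //.
  by rewrite monic_neq0 // Cyclotomic_monic.
have size_intr (S : numDomainType) (p : {poly int}) :
    size (map_poly intr p : {poly S}) = size p.
  by rewrite size_map_inj_poly //; apply: intr_inj.
pose P : {poly R[i]} := \prod_(i < n) (map_poly intr g \Po (zeta R n ^+ i *: 'X)).
have [s sE] : exists s : bool, map_poly intr D = (-1) ^+ s *: P.
  by case: g_eq => ->; [exists false | exists true]; rewrite ?scale1r ?scaleN1r.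
have P_neq0 : P != 0.
  apply: contraNneq D_neq0 => P0; rewrite -size_poly_eq0 -(size_intr R[i]).
  by rewrite sE P0 scaler0 size_poly0.
have size_lin i : size (zeta R n ^+ i *: 'X) = 2.
  by rewrite size_scale ?size_polyX // expf_neq0 // (prim_root_eq0 prim_z) -lt0n.
have g_neq0 : map_poly intr g != 0 :> {poly R[i]}.
  apply: contraNneq P_neq0 => g0.
  by rewrite /P (bigD1 (Ordinal n_gt0)) //= g0 comp_poly0 mul0r.
(* The factor of [P] at [i = 0] is [g] itself. *)
have g_dvd : (map_poly intr g : {poly R[i]}) %| map_poly intr D.
  rewrite sE dvdpZr ?signr_eq0 // /P (bigD1 (Ordinal n_gt0)) //=.
  by rewrite expr0 scale1r comp_polyXr dvdp_mulIl.
have deg_g : (size g).-1 = (k * totient m)%N.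
  have /(congr1 predn) : size D = size P.
    by rewrite -(size_intr R[i]) sE size_scale // signr_eq0.
  rewrite size_comp_poly size_polyXn size_exp size_Cyclotomic /=.
  rewrite /P size_prod => [|i _]; last by rewrite comp_poly2_eq0.
  rewrite (eq_bigr (fun=> size g)) => [|i _]; last first.
    by rewrite size_comp_poly2 ?size_intr.
  (* The size of [P] is [(n * size g).+1 - n]; as [size g] is positive, the degree is
     [n * (size g - 1)], and [n] cancels. *)
  rewrite sum_nat_const card_ord -[X in (_ - X)%N]muln1 subSn ?leq_mul //=.
    rewrite -mulnBr subn1 mulnC (mulnC _ k) => /eqP.
    by rewrite eqn_pmul2l // => /eqP.
  by rewrite -(size_intr R[i]) size_poly_gt0.
(* The factorization lives over [R[i]], while the roots are studied in [algC]; divisibility passes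
   through [rat], which embeds in both. *)
have ratrE (S : numFieldType) (p : {poly int}) :
    map_poly ratr (map_poly intr p : {poly rat}) = map_poly intr p :> {poly S}.
  by rewrite -map_poly_comp; apply: eq_map_poly => c; rewrite /= rmorph_int.
have g_neq0Q : map_poly intr g != 0 :> {poly rat}.
  by rewrite -size_poly_eq0 size_intr -(size_intr R[i]) size_poly_eq0.
have g_dvdQ : (map_poly intr g : {poly rat}) %| map_poly intr D.
  by rewrite -(dvdp_map (ratr : rat -> R[i])) !ratrE.
suff : (a * totient m %| k * totient m)%N by rewrite dvdn_pmul2r // totient_gt0.
rewrite -deg_g -(size_intr rat); apply: size_dvd_of_roots => // x x_root.
apply: (root_Cyclotomic_comp m_gt0 _ co_ma co_bm); rewrite -?nE //.
have : root (map_poly intr D) x.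
  have /dvdpP[q DE] := g_dvdQ.
  by rewrite -ratrE DE rmorphM rootM x_root orbT.
by rewrite /D !rmorphXn /root /= horner_exp expf_eq0 k_gt0.
Qed.
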